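(* Let $Q=(q_{ij})$ be a real $m\times n$ matrix, $c\in\mathbb{R}^m$, $d\in\mathbb{R}^n$, and let $x\in[0,1]^m$, $y\in[0,1]^n$. Define $x^0\in\{0,1\}^m$ and then $y^0\in\{0,1\}^n$ by $$x^0_i=\begin{cases}1&\text{if } c_i+\sum_{j=1}^n q_{ij}y_j>0,\\0&\text{otherwise,}\end{cases}\qquad y^0_j=\begin{cases}1&\text{if } d_j+\sum_{i=1}^m q_{ij}x^0_i>0,\\0&\text{otherwise.}\end{cases}$$ Then $f(x^0,y^0)\ge f(x,y)$.
   Context: For $x\in[0,1]^m$ and $y\in[0,1]^n$, $f(x,y)=\sum_{i=1}^m\sum_{j=1}^n q_{ij}x_iy_j+\sum_{i=1}^m c_ix_i+\sum_{j=1}^n d_jy_j$. The construction of $(x^0,y^0)$ from $(x,y)$ is called the round-$x$ optimize-$y$ (RxOy) algorithm. *)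

(* Defs.v *)
From mathcomp Require Export all_boot all_order all_algebra.
From mathcomp Require Export reals.

Set Implicit Arguments.
Unset Strict Implicit.
Unset Printing Implicit Defensive.

Import Order.TTheory GRing.Theory Num.Theory.
Local Open Scope ring_scope.

Definition in_unit_box (R : realType) (k : nat) (z : 'cV[R]_k) : Prop :=
  forall i : 'I_k, 0 <= z i 0 <= 1.

(* The objective f(x, y); [Q], [c], [d] are the coefficients q_ij, c_i, d_j. *)
Definition bqp_obj (R : realType) (m n : nat) (Q : 'M[R]_(m, n))
    (c : 'cV[R]_m) (d : 'cV[R]_n) (x : 'cV[R]_m) (y : 'cV[R]_n) : R :=
  \sum_(i < m) \sum_(j < n) Q i j * x i 0 * y j 0
  + \sum_(i < m) c i 0 * x i 0
  + \sum_(j < n) d j 0 * y j 0.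

(* x^0 is determined by y alone, and y^0 by x^0 alone. *)
Definition round_x (R : realType) (m n : nat) (Q : 'M[R]_(m, n))
    (c : 'cV[R]_m) (y : 'cV[R]_n) : 'cV[R]_m :=
  \col_(i < m) (if 0 < c i 0 + \sum_(j < n) Q i j * y j 0 then 1 else 0).

Definition optimize_y (R : realType) (m n : nat) (Q : 'M[R]_(m, n))
    (d : 'cV[R]_n) (x0 : 'cV[R]_m) : 'cV[R]_n :=
  \col_(j < n) (if 0 < d j 0 + \sum_(i < m) Q i j * x0 i 0 then 1 else 0).

(* Main.v *)
Require Import Defs.
From mathcomp Require Import all_boot all_order all_algebra.
From mathcomp Require Import reals.

Import Order.TTheory GRing.Theory Num.Theory.
Local Open Scope ring_scope.

(** The objective is bilinear up to separate linear terms, so with one block of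
    variables fixed it is affine and separable in the other block. A separable
    affine function is maximised over the unit box coordinate by coordinate, by
    giving each variable the value 1 exactly when its coefficient is positive.
    With [y] fixed, the coefficient of [x i 0] is c_i + sum_j q_ij y_j, so
    [round_x] picks a maximiser in [x] ([bqp_obj_round_x]); with [x0] fixed,
    [optimize_y] picks a maximiser in [y] ([bqp_obj_optimize_y]). Hence
    f(x, y) <= f(x0, y) <= f(x0, y0). *)

Lemma ler_mul_threshold (R : realDomainType) (a t : R) :
  0 <= t <= 1 -> a * t <= a * (if 0 < a then 1 else 0).
Proof.
case/andP=> t_ge0 t_le1; case: ltP => [a_gt0 | a_le0].
  by rewrite ler_pM2l.
by rewrite mulr0 mulr_le0_ge0.
Qed.

Lemma bqp_obj_affine_x (R : realType) (m n : nat) (Q : 'M[R]_(m, n))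
    (c : 'cV[R]_m) (d : 'cV[R]_n) (x : 'cV[R]_m) (y : 'cV[R]_n) :
  bqp_obj Q c d x y =
    \sum_(i < m) (c i 0 + \sum_(j < n) Q i j * y j 0) * x i 0
    + \sum_(j < n) d j 0 * y j 0.
Proof.
rewrite /bqp_obj -big_split; congr (_ + _); apply: eq_bigr => i _ /=.
rewrite mulrDl addrC mulr_suml; congr (_ + _).
by apply: eq_bigr => j _; rewrite mulrAC.
Qed.

Lemma bqp_obj_affine_y (R : realType) (m n : nat) (Q : 'M[R]_(m, n))
    (c : 'cV[R]_m) (d : 'cV[R]_n) (x : 'cV[R]_m) (y : 'cV[R]_n) :
  bqp_obj Q c d x y =
    \sum_(j < n) (d j 0 + \sum_(i < m) Q i j * x i 0) * y j 0
    + \sum_(i < m) c i 0 * x i 0.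
Proof.
rewrite /bqp_obj addrAC exchange_big -big_split; congr (_ + _).
by apply: eq_bigr => j _ /=; rewrite mulrDl addrC mulr_suml.
Qed.

Lemma bqp_obj_round_x (R : realType) (m n : nat) (Q : 'M[R]_(m, n))
    (c : 'cV[R]_m) (d : 'cV[R]_n) (x : 'cV[R]_m) (y : 'cV[R]_n) :
  in_unit_box x -> bqp_obj Q c d x y <= bqp_obj Q c d (round_x Q c y) y.
Proof.
move=> hx; rewrite !bqp_obj_affine_x lerD2r; apply: ler_sum => i _.
by rewrite mxE ler_mul_threshold.
Qed.

Lemma bqp_obj_optimize_y (R : realType) (m n : nat) (Q : 'M[R]_(m, n))
    (c : 'cV[R]_m) (d : 'cV[R]_n) (x : 'cV[R]_m) (y : 'cV[R]_n) :
  in_unit_box y -> bqp_obj Q c d x y <= bqp_obj Q c d x (optimize_y Q d x).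
Proof.
move=> hy; rewrite !bqp_obj_affine_y lerD2r; apply: ler_sum => j _.
by rewrite mxE ler_mul_threshold.
Qed.

Theorem theorem10 (R : realType) (m n : nat) (Q : 'M[R]_(m, n))
    (c : 'cV[R]_m) (d : 'cV[R]_n) (x : 'cV[R]_m) (y : 'cV[R]_n)
    (hx : in_unit_box x) (hy : in_unit_box y) :
  let x0 := round_x Q c y in
  let y0 := optimize_y Q d x0 in
  bqp_obj Q c d x0 y0 >= bqp_obj Q c d x y.
Proof.
rewrite /=; apply: le_trans (bqp_obj_round_x _ _ _ Q c d x y hx) _.
exact: bqp_obj_optimize_y.
Qed.
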